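(* Let $X$ be an isotropic $L$-space, $\omega$ an arbitrary modulus of continuity, $n\in\mathbb N$, and let ${\bf t}^*=(t_0^*,\dots,t_n^* )$ be the uniform partition of the segment $[a,b]$, $t_k^*=a+k(b-a)/n$. Let $I_{{\bf t}^*}(f)=(f(t_0^* ),\dots,f(t_n^* ))$. Then $$\mathcal E(\mathcal D_H,W^1H^\omega([a,b],X),I_{{\bf t}^*},B([a,b],X))=\frac n{b-a}\int_0^{(b-a)/n}\omega(u)\,du.$$ The optimal method of recovery is $\Phi(f(t_0^* ),f(t_1^* ),\dots,f(t_n^* ))=\mathcal D_Hl_f({\bf t}^* )$, i.e. the error of this method equals the right-hand side. Here $$\mathcal D_Hl_f({\bf t}^*;t)=\frac{f(t^*_{k+1})-_Hf(t^*_k)}{t^*_{k+1}-t^*_k}\ \text{ for } t\in[t^*_k,t^*_{k+1}),\ k=0,\dots,n-1,\qquad \mathcal D_Hl_f({\bf t}^*;t_n^* )=\frac{f(t_n^* )-_Hf(t_{n-1}^* )}{t_n^*-t_{n-1}^*}.$$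
   Context: A modulus of continuity is a non-decreasing continuous semi-additive function $\omega\colon[0,\infty)\to[0,\infty)$ (i.e. $\omega(s+t)\le\omega(s)+\omega(t)$) with $\omega(0)=0$. A semilinear space is a set $X$ with addition and multiplication by real numbers such that for all $x,y,z\in X$, $\alpha,\beta\in\mathbb R$: $x+y=y+x$; $x+(y+z)=(x+y)+z$; there is $\theta\in X$ with $x+\theta=x$ for all $x$; $\alpha(x+y)=\alpha x+\alpha y$; $\alpha(\beta x)=(\alpha\beta)x$; $1\cdot x=x$, $0\cdot x=\theta$. An $L$-space is a semilinear space $X$ with a complete separable metric $h_X$ such that $h_X(\alpha x,\alpha y)=|\alpha|h_X(x,y)$ and $h_X(x+z,y+z)\le h_X(x,y)$; it is isotropic if the last inequality is always an equality. An element $x$ is convex if $(\alpha+\beta)x=\alpha x+\beta x$ for all $\alpha,\beta\ge0$; $X^{\rm c}$ is the set of convex elements. An element $x$ is invertible if there is $x'\in X$ with $x+x'=\theta$; $X^{\rm inv}$ is the set of invertible elements. Standing assumption: $X^{\rm inv}\cap X^{\rm c}\ne\{\theta\}$. $X$ is equipped with a fixed convexifying operator $P$: a surjection $P\colon X\to X^{\rm c}$ with $h_X(P(x),P(y))\le h_X(x,y)$, $P\circ P=P$, $P(\alpha x+\beta y)=\alpha P(x)+\beta P(y)$ for all $x,y\in X$, $\alpha,\beta\in\mathbb R$. Integral: for a simple mapping $f$ taking values $f_1,\dots,f_n$ on pairwise disjoint measurable sets $T_1,\dots,T_n$, $\int f(s)\,ds:=\sum_iP(f_i)\mu(T_i)$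 ($\mu$ the Lebesgue measure); for a uniform limit $f$ of simple mappings $f^k$ (in particular for continuous $f$), $\int f:=\lim_k\int f^k$. Hukuhara type difference: $z=x-_Hy$ means $x=y+z$ (unique, if it exists, in an isotropic space). $f$ has Hukuhara type derivative $\mathcal D_Hf(t)$ at $t\in(a,b)$ if for all small $\gamma>0$ the differences $f(t+\gamma)-_Hf(t)$, $f(t)-_Hf(t-\gamma)$ exist and the limits as $\gamma\to+0$ of $\gamma^{-1}(f(t+\gamma)-_Hf(t))$ and $\gamma^{-1}(f(t)-_Hf(t-\gamma))$ exist and coincide; $\mathcal D_Hf(t)$ is the common limit (one-sided at $t=a,b$). $H^\omega([a,b],X)$ is the class of $f\colon[a,b]\to X$ with $h_X(f(t'),f(t''))\le\omega(|t'-t''|)$ for all $t',t''\in[a,b]$. $W^1H^\omega([a,b],X)$ is the class of functions $f(t)=x+\int_a^t\phi(s)\,ds$ with $\phi\in H^\omega([a,b],X)$, $x\in X^{\rm c}$; for such $f$, $\mathcal D_Hf=P(\phi)$. $B([a,b],X)$ is the space of bounded measurable functions $f\colon[a,b]\to X$ (measurable: $t\mapsto h_X(f(t),x)$ is measurable for each $x\in X$) with metric $\sup_th_X(f(t),g(t))$. Optimal recovery: given a metric space $(E,h_E)$, sets $Z,Y$, a class $W\subset Z$, and mappings $\Lambda\colon Z\to E$, $I\colon W\to Y$, a method of recovery is an arbitrary mapping $\Phi\colon Y\to E$; its error is $\mathcal E(\Lambda,W,I,\Phi,E)=\sup_{z\in W}h_E(\Lambda(z),\Phi(I(z)))$, and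 $\mathcal E(\Lambda,W,I,E)=\inf_\Phi\mathcal E(\Lambda,W,I,\Phi,E)$. Here methods take values in $B([a,b],X)$ and are defined on the information vectors $I_{{\bf t}^*}(f)$, $f\in W^1H^\omega([a,b],X)$ (for which the Hukuhara differences above exist). *)

(* Defs.v *)
From HB Require Import structures.
From mathcomp Require Import all_boot all_order all_algebra.
From mathcomp Require Import all_classical all_reals all_analysis.

Set Implicit Arguments.
Unset Strict Implicit.
Unset Printing Implicit Defensive.

Import Order.TTheory GRing.Theory Num.Theory.
Import numFieldTopology.Exports numFieldNormedType.Exports.

Local Open Scope classical_set_scope.
Local Open Scope ring_scope.

(* The library's semimodules are too strong: they satisfy
   (a + b) *: x = a *: x + b *: x, which below only convex elements do (and only
   for a, b >= 0). The addition is not taken from nmodType either, because HB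
   has no join of nmodType with metricType below pseudoMetricNormedZmodType. *)
HB.mixin Record isSemilinear (R : realType) X & Choice X := {
  sadd : X -> X -> X ;
  theta : X ;
  sscale : R -> X -> X ;
  saddC : commutative sadd ;
  saddA : associative sadd ;
  sadd0 : right_id theta sadd ;
  sscaleDr : forall (al : R) (x y : X),
    sscale al (sadd x y) = sadd (sscale al x) (sscale al y) ;
  sscaleA : forall (al be : R) (x : X),
    sscale al (sscale be x) = sscale (al * be) x ;
  sscale1 : forall x : X, sscale 1 x = x ;
  sscale0 : forall x : X, sscale 0 x = theta
}.

#[short(type="semilinearType")]
HB.structure Definition Semilinear (R : realType) :=
  { X of Choice X & isSemilinear R X }.

Arguments sadd {R s}.
Arguments theta {R s}.
Arguments sscale {R s}.

Notation "x +.: y" := (sadd x y) (at level 50, left associativity) : ring_scope.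
Notation "al *.: x" := (sscale al x) (at level 40) : ring_scope.

Lemma sadd0l (R : realType) (X : semilinearType R) :
  left_id (@theta R X) sadd.
Proof. by move=> x; rewrite saddC sadd0. Qed.

HB.instance Definition _ (R : realType) (X : semilinearType R) :=
  Monoid.isComLaw.Build X theta sadd saddA saddC (@sadd0l R X).

HB.mixin Record isLSpace (R : realType) X
    & Complete X & Metric R X & Semilinear R X := {
  lspace_separable : exists2 D : set X, countable D & dense D ;
  mdist_sscale : forall (al : R) (x y : X),
    mdist (al *.: x) (al *.: y) = `|al| * mdist x y ;
  mdist_sadd_le : forall x y z : X, mdist (x +.: z) (y +.: z) <= mdist x y
}.

#[short(type="lspaceType")]
HB.structure Definition LSpace (R : realType) :=
  { X of Complete X & Metric R X & Semilinear R X & isLSpace R X }.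

Section LSpaces.
Context {R : realType} {X : lspaceType R}.
Implicit Types (a b t : R) (x y z : X) (f g phi : R -> X) (P : X -> X).
Implicit Type omega : R -> R.

Definition isotropic := forall x y z, mdist (x +.: z) (y +.: z) = mdist x y.

Definition convex_elements : set X :=
  [set x | forall al be : R, 0 <= al -> 0 <= be ->
    (al + be) *.: x = al *.: x +.: be *.: x].

Definition invertible_elements : set X :=
  [set x | exists x', x +.: x' = theta].

Record convexifying P : Prop := {
  convexifying_range : range P = convex_elements ;
  convexifying_dist : forall x y, mdist (P x) (P y) <= mdist x y ;
  convexifying_idem : forall x, P (P x) = P x ;
  convexifying_linear : forall (al be : R) x y,
    P (al *.: x +.: be *.: y) = al *.: P x +.: be *.: P y
}.

(* R with the sigma-algebra of the Lebesgue measurable sets (R itself carries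
   the Borel sets), on which completed_lebesgue_measure is a measure. *)
Definition lebesgueTypeR := caratheodory_type ((@wlength R idfun)^*)%mu.

Definition measurable_map (D : set R) f : Prop :=
  forall x, measurable_fun (D : set lebesgueTypeR)
    ((fun t => mdist (f t) x) : lebesgueTypeR -> R).

Definition is_simple_integral P (D : set R) f (v : X) : Prop :=
  exists (m : nat) (c : 'I_m -> X) (T : 'I_m -> set lebesgueTypeR),
    [/\ forall i, measurable (T i),
        trivIset setT T,
        \bigcup_i T i = D,
        forall i t, T i t -> f t = c i &
        v = \big[sadd/theta]_(i < m) (fine (completed_lebesgue_measure (T i)) *.: P (c i))].

Definition is_integral P (D : set R) f (v : X) : Prop :=
  exists (fk : nat -> R -> X) (vk : nat -> X),
    [/\ forall k, is_simple_integral P D (fk k) (vk k),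
        {uniform D, fk @ \oo --> f} &
        vk k @[k --> \oo] --> v].

(* theta is a junk value, used only where no integral (below: difference,
   derivative) exists. *)
Definition lintegral P (D : set R) f : X := xget theta (is_integral P D f).

Definition hdiff x y : X := xget theta [set z | x = y +.: z].

Definition is_hderiv_right f t (d : X) : Prop :=
  (\forall h \near 0^'+, exists z, f (t + h) = f t +.: z) /\
  h^-1 *.: hdiff (f (t + h)) (f t) @[h --> 0^'+] --> d.

Definition is_hderiv_left f t (d : X) : Prop :=
  (\forall h \near 0^'+, exists z, f t = f (t - h) +.: z) /\
  h^-1 *.: hdiff (f t) (f (t - h)) @[h --> 0^'+] --> d.

(* One-sided at the endpoints of [a, b]; only meant for t in [a, b]. *)
Definition is_hderiv a b f t (d : X) : Prop :=
  (t < b -> is_hderiv_right f t d) /\ (a < t -> is_hderiv_left f t d).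

Definition hderiv a b f : R -> X := fun t => xget theta (is_hderiv a b f t).

(* A function [0, oo) -> [0, oo) is encoded by omega : R -> R; its values at
   negative arguments are irrelevant. *)
Record modulus_of_continuity omega : Prop := {
  modulus_ge0 : forall s, 0 <= s -> 0 <= omega s ;
  modulus_nondecreasing :
    forall s t, 0 <= s -> s <= t -> omega s <= omega t ;
  modulus_continuous : {within `[0, +oo[, continuous omega} ;
  modulus_semiadditive :
    forall s t, 0 <= s -> 0 <= t -> omega (s + t) <= omega s + omega t ;
  modulus0 : omega 0 = 0
}.

(* Functions [a, b] -> X are encoded by functions R -> X; all the notions
   below only depend on their values on [a, b]. *)
Definition Homega omega a b : set (R -> X) :=
  [set f | {in `[a, b] &, forall t' t'',
    mdist (f t') (f t'') <= omega `|t' - t''|}].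

Definition W1Homega P omega a b : set (R -> X) :=
  [set f | exists x phi, [/\ convex_elements x, Homega omega a b phi &
    {in `[a, b], forall t, f t = x +.: lintegral P `[a, t] phi}]].

Definition bounded_measurable a b : set (R -> X) :=
  [set f | measurable_map `[a, b] f /\
    exists M : R, {in `[a, b], forall t, mdist (f t) theta <= M}].

Definition sup_dist a b f g : \bar R :=
  ereal_sup [set (mdist (f t) (g t))%:E | t in `[a, b]].

Definition info n (t_ : 'I_n.+1 -> R) f : {ffun 'I_n.+1 -> X} :=
  [ffun k => f (t_ k)].

(* The derivative of the interpolating polygon with nodes t_ and values y,
   extended by theta outside of [t_ 0, t_ n]. *)
Definition hderiv_polygon n (t_ : 'I_n.+1 -> R) (y : {ffun 'I_n.+1 -> X}) :
    R -> X := fun t =>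
  let lo (k : 'I_n) := widen_ord (leqnSn n) k in
  let hi (k : 'I_n) := lift ord0 k in
  if [pick k : 'I_n | (t_ (lo k) <= t) &&
        ((t < t_ (hi k)) || (k.+1 == n) && (t == t_ (hi k)))] is Some k
  then (t_ (hi k) - t_ (lo k))^-1 *.: hdiff (y (hi k)) (y (lo k))
  else theta.

End LSpaces.
Arguments isotropic {R} X.
Arguments convex_elements {R} X.
Arguments invertible_elements {R} X.

Definition uniform_partition {R : realType} (a b : R) n (k : 'I_n.+1) : R :=
  a + k%:R * (b - a) / n%:R.

(* The metric space in which the values are recovered is the subset B of E
   with the distance hE; a method is only constrained on the information that
   can actually be received, that is, on the image of W by Info. *)
Section OptimalRecovery.
Context {R : realType} {Z Y E : Type}.
Variables (B : set E) (hE : E -> E -> \bar R).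
Variables (Lam : Z -> E) (W : set Z) (Info : Z -> Y).

Definition recovery_methods : set (Y -> E) :=
  [set Phi | forall z, W z -> B (Phi (Info z))].

Definition recovery_error (Phi : Y -> E) : \bar R :=
  ereal_sup [set hE (Lam z) (Phi (Info z)) | z in W].

Definition optimal_recovery_error : \bar R :=
  ereal_inf [set recovery_error Phi | Phi in recovery_methods].

End OptimalRecovery.

(* Main.v *)
(** The upper bound: on a cell [[t_k, t_{k+1}]] of length [h], the polygon has
    slope [h^-1 *.: \int phi], and [D_H f t = P (phi t)] is the mean of the
    constant [phi t]; their distance is at most
    [h^-1 * (Omega (t - t_k) + Omega (t_{k+1} - t)) <= h^-1 * Omega h], where
    [Omega p] is the integral of [omega] over [[0, p]].

    The lower bound: the line spanned by a nonzero invertible convex element is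
    an isometric copy [L] of [R] in [X]. The functions
    [phi s = L (+- (omega (dist s) - e))], where [dist] is the distance to the
    nodes of even index, belong to [H^omega] and have integral [theta] over each
    cell, so their primitives cannot be told apart by the information, whereas
    their derivatives [L (-+ e)] at [a] are at distance [2 * e].

    Integrals are compared through increments: two curves whose increments over
    a step [d] differ by [O(d * omega d)] coincide, by refining the step. *)
Require Import Defs.
From mathcomp Require Import all_boot all_order all_algebra.
From mathcomp Require Import all_classical all_reals all_analysis.
From mathcomp Require Import ring lra.

Set Implicit Arguments.
Unset Strict Implicit.
Unset Printing Implicit Defensive.

Import Order.TTheory GRing.Theory Num.Theory.
Import numFieldTopology.Exports numFieldNormedType.Exports.

Local Open Scope classical_set_scope.
Local Open Scope ring_scope.

(** * Integration of continuous mappings *)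

Section LebesgueSets.
Context {R : realType}.
Local Notation cmu := (@completed_lebesgue_measure R).
Implicit Types A D : set (@lebesgueTypeR R).

Lemma lebesgueTypeR_measurable_itv (i : interval R) :
  measurable ([set` i] : set (@lebesgueTypeR R)).
Proof. by apply: sub_caratheodory; exact: measurable_itv. Qed.

Lemma completed_lebesgue_measure_itv (i : interval R) :
  cmu [set` i] = lebesgue_measure [set` i].
Proof. by []. Qed.

Lemma completed_lebesgue_measure_cc (s t : R) : s <= t ->
  cmu `[s, t] = (t - s)%:E.
Proof.
move=> st; rewrite completed_lebesgue_measure_itv lebesgue_measure_itv/= lte_fin.
by case: ltgtP st => // -> _; rewrite subrr.
Qed.

Lemma measure_fin_num_sub A D : measurable A -> measurable D ->
  cmu D \is a fin_num -> A `<=` D -> cmu A \is a fin_num.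
Proof.
move=> mA mD; rewrite !ge0_fin_numE// => fD AD.
by apply: le_lt_trans fD; apply: le_measure => //; rewrite inE.
Qed.

Lemma fine_measure_partition (m : nat) (T : 'I_m -> set (@lebesgueTypeR R)) A :
  (forall i, measurable (T i)) -> trivIset setT T -> measurable A ->
  cmu A \is a fin_num -> A `<=` \bigcup_i T i ->
  fine (cmu A) = \sum_(i < m) fine (cmu (A `&` T i)).
Proof.
move=> mT tT mA fA AT.
have mAT i : measurable (A `&` T i) by exact: measurableI.
have fAT i : cmu (A `&` T i) \is a fin_num.
  exact: (measure_fin_num_sub (mAT i) mA fA (@subIsetl _ _ _)).
rewrite sum_fine//; congr fine.
rewrite -measure_semi_additive_ord//.
- congr (cmu _); rewrite -bigcup_seq/=; apply/seteqP; split => [x Ax|x].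
    by have [i _ Tix] := AT _ Ax; exists i => //=; rewrite mem_index_enum.
  by case=> i _ [].
- apply/trivIsetP => i j _ _ ij; rewrite setIACA setIid.
  by move/trivIsetP : tT => /(_ i j I I ij) ->; rewrite setI0.
- by apply: bigsetU_measurable.
Qed.

End LebesgueSets.

(** * Distance estimates and cancellation in L-spaces *)

Section LSpaceTheory.
Context {R : realType} {X : lspaceType R}.
Implicit Types (x y z w : X) (al be : R).

Lemma sscale_theta al : al *.: theta = theta :> X.
Proof. by rewrite -(sscale0 (@theta R X)) sscaleA mulr0. Qed.

Lemma mdist_sadd x y z w :
  mdist (x +.: y) (z +.: w) <= mdist x z + mdist y w.
Proof.
apply: (le_trans (metric_triangle _ (z +.: y) _)); apply: lerD.
  exact: mdist_sadd_le.
by rewrite !(saddC z); exact: mdist_sadd_le.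
Qed.

Lemma mdist_ssum (I : Type) (r : seq I) (F G : I -> X) :
  mdist (\big[sadd/theta]_(i <- r) F i) (\big[sadd/theta]_(i <- r) G i) <=
  \sum_(i <- r) mdist (F i) (G i).
Proof.
elim: r => [|i r IH]; first by rewrite !big_nil mdistxx.
by rewrite !big_cons; apply: (le_trans (mdist_sadd _ _ _ _)); rewrite lerD2l.
Qed.

(** Used to split the weight of a piece among the pieces of a finer partition. *)
Lemma convex_scale_sum x (I : Type) (r : seq I) (F : I -> R) :
  convex_elements X x -> (forall i, 0 <= F i) ->
  (\sum_(i <- r) F i) *.: x = \big[sadd/theta]_(i <- r) (F i *.: x).
Proof.
move=> cx F0; elim: r => [|i r IH]; first by rewrite !big_nil sscale0.
by rewrite !big_cons cx ?sumr_ge0// IH.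
Qed.

Lemma isotropic_saddI : isotropic X -> right_injective (@sadd R X).
Proof.
move=> isoX z x y zxy; apply: mdist_positivity.
by rewrite -(isoX x y z) !(saddC _ z) zxy mdistxx.
Qed.

Lemma hdiff_saddl x z : isotropic X -> hdiff (x +.: z) x = z.
Proof.
move=> isoX; apply: xget_unique => // y.
by move=> /esym/(isotropic_saddI isoX).
Qed.

(** * Stability, uniqueness and additivity of the integral *)

Section Integral.
Variables (P : X -> X).
Hypothesis convP : convexifying P.
Local Notation cmu := (@completed_lebesgue_measure R).
Implicit Types (D : set (@lebesgueTypeR R)) (f g : R -> X).

Lemma convexifying_convex x : convex_elements X (P x).
Proof. by rewrite -(convexifying_range convP); exists x. Qed.

Lemma convexifying_fixed x : convex_elements X x -> P x = x.
Proof.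
by rewrite -(convexifying_range convP) => -[y _ <-]; exact: convexifying_idem.
Qed.

(** Both sums are rewritten over the common refinement by the intersections of [T i] with [S j].
    Splitting the weights is legitimate because the values of [P] are convex. *)
Lemma simple_integral_dist D f g v w eps :
    measurable D -> cmu D \is a fin_num ->
    is_simple_integral P D f v -> is_simple_integral P D g w ->
    (forall t, D t -> mdist (f t) (g t) <= eps) ->
  mdist v w <= fine (cmu D) * eps.
Proof.
move=> mD fD [m [c [T [mT tT TD fT ->]]]] [p [d [S [mS tS SD gS ->]]]] fg.
have TS i : T i `<=` D by move=> t Tit; rewrite -TD; exists i.
have SSD j : S j `<=` D by move=> t Sjt; rewrite -SD; exists j.
have fTi i := measure_fin_num_sub (mT i) mD fD (TS i).
have fSj j := measure_fin_num_sub (mS j) mD fD (SSD j).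
pose l i j : R := fine (cmu (T i `&` S j)).
have l0 i j : 0 <= l i j by apply: fine_ge0; exact: measure_ge0.
have lT i : fine (cmu (T i)) = \sum_(j < p) l i j.
  by apply: fine_measure_partition => //; rewrite SD.
have lS j : fine (cmu (S j)) = \sum_(i < m) l i j.
  rewrite (@fine_measure_partition _ _ T)// ?TD//.
  by apply: eq_bigr => i _; rewrite setIC.
have -> : \big[sadd/theta]_(i < m) (fine (cmu (T i)) *.: P (c i)) =
    \big[sadd/theta]_(i < m) \big[sadd/theta]_(j < p) (l i j *.: P (c i)).
  apply: eq_bigr => i _; rewrite lT convex_scale_sum//.
  exact: convexifying_convex.
have -> : \big[sadd/theta]_(j < p) (fine (cmu (S j)) *.: P (d j)) =
    \big[sadd/theta]_(i < m) \big[sadd/theta]_(j < p) (l i j *.: P (d j)).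
  rewrite exchange_big/=.
  apply: eq_bigr => j _; rewrite lS convex_scale_sum//.
  exact: convexifying_convex.
have -> : fine (cmu D) = \sum_(i < m) \sum_(j < p) l i j.
  rewrite (@fine_measure_partition _ _ T)// ?TD//.
  by apply: eq_bigr => i _; rewrite -lT setIidr//; exact: TS.
apply: (le_trans (mdist_ssum _ _ _)); rewrite mulr_suml.
apply: ler_sum => i _; apply: (le_trans (mdist_ssum _ _ _)); rewrite mulr_suml.
apply: ler_sum => j _; rewrite mdist_sscale ger0_norm//.
(* An empty intersection has weight zero; otherwise a common point ties [c i] and [d j] to values of
   [f] and [g]. *)
have [TS0|/set0P[t [Tt St]]] := eqVneq (T i `&` S j) set0.
  by rewrite /l TS0 measure0 !mul0r.
apply: ler_wpM2l => //; apply: (le_trans (convexifying_dist convP _ _)).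
by rewrite -(fT _ _ Tt) -(gS _ _ St); apply: fg; apply: TS Tt.
Qed.

Lemma uniform_mdistP (D : set R) (fk : nat -> R -> X) f :
  {uniform D, fk @ \oo --> f} <-> (forall eps, 0 < eps ->
    \forall k \near \oo, forall t, D t -> mdist (f t) (fk k t) < eps).
Proof.
split=> [fkf e e0|H].
  have : nbhs (f : {uniform` D -> X})
      [set g : R -> X | forall t, D t -> mdist (f t) (g t) < e].
    apply/uniform_nbhs; exists [set xy | ball xy.1 e xy.2]; split.
      exact: entourage_ball (PosNum e0).
    by move=> g fg t Dt; have := fg t Dt; rewrite /= ballEmdist.
  by move=> /fkf.
move=> /= U /uniform_nbhs[E [entE EU]].
have := entE; rewrite -entourage_ballE => -[e /= e0 eE].
rewrite /nbhs/= /fmap/=; move: (H e e0); apply: filterS => k fk1.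
apply: EU => t Dt; apply: eE => /=; rewrite ballEmdist/=; exact: fk1.
Qed.

Lemma integral_dist D f g v w eps :
    measurable D -> cmu D \is a fin_num ->
    is_integral P D f v -> is_integral P D g w ->
    (forall t, D t -> mdist (f t) (g t) <= eps) ->
  mdist v w <= fine (cmu D) * eps.
Proof.
move=> mD fD [fk [vk [fks /uniform_mdistP fkf vkv]]].
move=> [gk [wk [gks /uniform_mdistP gkg wkw]]] fg.
set K := fine (cmu D); have K0 : 0 <= K by apply: fine_ge0; exact: measure_ge0.
apply/ler_addgt0Pr => e e0.
(* The two limits cost [2 * e1] and the two uniform approximations [2 * K * e1], in total [e]. *)
pose e1 := e / (2 * (K + 1)).
have e10 : 0 < e1 by rewrite divr_gt0// mulr_gt0// ltr_wpDl.
near \oo => k.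
have fk1 : forall t, D t -> mdist (f t) (fk k t) < e1.
  by near: k; exact: fkf.
have gk1 : forall t, D t -> mdist (g t) (gk k t) < e1.
  by near: k; exact: gkg.
have vk1 : mdist v (vk k) < e1.
  by near: k; move/metricType_numDomainType.cvgrPdist_lt : vkv; exact.
have wk1 : mdist w (wk k) < e1.
  by near: k; move/metricType_numDomainType.cvgrPdist_lt : wkw; exact.
have vw : mdist (vk k) (wk k) <= K * (e1 + eps + e1).
  apply: (simple_integral_dist mD fD (fks k) (gks k)) => t Dt.
  apply: (le_trans (metric_triangle _ (g t) _)).
  apply: lerD; last exact/ltW/gk1.
  apply: (le_trans (metric_triangle _ (f t) _)).
  apply: lerD; last exact: fg.
  by rewrite metric_sym; exact/ltW/fk1.
have -> : e = 2 * (K + 1) * e1.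
  by rewrite /e1; field; rewrite gt_eqF// ltr_wpDl.
have := metric_triangle v (vk k) w; have := metric_triangle (vk k) (wk k) w.
rewrite (metric_sym (wk k)); nra.
Unshelve. all: by end_near. Qed.

Lemma is_integral_unique D f v w :
    measurable D -> cmu D \is a fin_num ->
  is_integral P D f v -> is_integral P D f w -> v = w.
Proof.
move=> mD fD fv fw; apply: mdist_positivity; apply/eqP.
rewrite eq_le mdist_ge0 andbT -(mulr0 (fine (cmu D))).
by apply: (integral_dist mD fD fv fw) => t _; rewrite mdistxx.
Qed.

Lemma lintegralE D f v :
    measurable D -> cmu D \is a fin_num ->
  is_integral P D f v -> lintegral P D f = v.
Proof.
move=> mD fD fv; apply: xget_unique => // w fw.
exact: is_integral_unique fw fv.
Qed.

Lemma is_integral_cst D x : measurable D ->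
  is_integral P D (cst x) (fine (cmu D) *.: P x).
Proof.
move=> mD; exists (fun=> cst x), (fun=> fine (cmu D) *.: P x); split.
- move=> k; exists 1%N, (fun=> x), (fun=> D); split => //.
  + by move=> i j _ _ _; rewrite !ord1.
  + by rewrite bigcup_const//; exists ord0.
  + by rewrite big_ord1.
- by apply/uniform_mdistP => e e0; near=> k => t _; rewrite mdistxx.
- exact: cvg_cst.
Unshelve. all: by end_near. Qed.

(** Lets the common endpoint of two adjacent closed intervals be removed from one of them: every
    piece keeps its measure. *)
Lemma is_integral_null D N f v : measurable N -> cmu N = 0%E -> measurable D ->
  is_integral P D f v -> is_integral P (D `\` N) f v.
Proof.
move=> mN N0 mD [fk [vk [fks fkf vkv]]]; exists fk, vk; split => //.
  move=> k; have [m [c [T [mT tT TD fT ->]]]] := fks k.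
  exists m, c, (fun i => T i `\` N); split.
  - by move=> i; exact: measurableD.
  - apply/trivIsetP => i j _ _ ij; apply/seteqP; split => // x [[Ti _] [Tj _]].
    by move/trivIsetP : tT => /(_ i j I I ij); rewrite -subset0; exact.
  - by rewrite -TD setD_bigcupl.
  - by move=> i t [Tit _]; exact: fT.
  - apply: eq_bigr => i _; congr (fine _ *.: _).
    have mTN : measurable (T i `&` N) by exact: measurableI.
    have TN0 : cmu (T i `&` N) = 0%E.
      apply/eqP; rewrite eq_le measure_ge0 andbT -N0.
      by apply: le_measure; rewrite ?inE//; exact: subIsetr.
    rewrite -{1}(setUIDK (T i) N).
    rewrite measureU//; last 2 first.
    - exact: measurableD.
    - by apply/seteqP; split => // x [[_ ?] [_]].
    by rewrite [X in (X + _)%E]TN0 add0e.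
apply/uniform_mdistP => e e0; move/uniform_mdistP : fkf => /(_ _ e0).
by apply: filterS => k fke t [Dt _]; exact: fke.
Qed.

(** Simple approximations on the two sets are glued, and their pieces are listed together as one
    family indexed by ['I_(m + p)]. *)
Lemma is_integral_setU D1 D2 f v w : [disjoint D1 & D2] ->
    is_integral P D1 f v -> is_integral P D2 f w ->
  is_integral P (D1 `|` D2) f (v +.: w).
Proof.
move=> /disj_setPS D12 [fk [vk [fks /uniform_mdistP fkf vkv]]].
move=> [gk [wk [gks /uniform_mdistP gkg wkw]]].
have D1F t : D2 t -> (t \in (D1 : set R)) = false.
  by move=> D2t; apply/negbTE; rewrite notin_setE => D1t; exact: (D12 t).
exists (fun k t => if t \in D1 then fk k t else gk k t),
  (fun k => vk k +.: wk k).
split.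
- move=> k; have [m [c [T [mT tT TD fT ->]]]] := fks k.
  have [p [d [S [mS tS SD gS ->]]]] := gks k.
  have TDi i t : T i t -> D1 t by move=> Tit; rewrite -TD; exists i.
  have SDj i t : S i t -> D2 t by move=> Tit; rewrite -SD; exists i.
  exists (m + p)%N, (fun i : 'I_(m + p) =>
      match fintype.split i with inl i => c i | inr j => d j end),
    (fun i : 'I_(m + p) =>
      match fintype.split i with inl i => T i | inr j => S j end); split.
  + by move=> i; case: (fintype.split i).
  + apply/trivIsetP => i j _ _; rewrite -(inj_eq (can_inj (@splitK _ _))).
    case: (fintype.split i) => i'; case: (fintype.split j) => j' ij.
    * by move/trivIsetP : tT; apply.
    * by rewrite -subset0 => t [/TDi D1t /SDj D2t]; exact: (D12 t).
    * by rewrite -subset0 => t [/SDj D1t /TDi D2t]; exact: (D12 t).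
    * by move/trivIsetP : tS; apply.
  + rewrite -TD -SD; apply/seteqP; split => [t [i _]|t [[i _ Tit]|[i _ Sit]]].
    * by case: (fintype.split i) => j ?; [left|right]; exists j.
    * by exists (lshift p i) => //; rewrite (unsplitK (inl i)).
    * by exists (rshift m i) => //; rewrite (unsplitK (inr i)).
  + move=> i t; case: (fintype.split i) => j Tt.
    * by rewrite mem_set ?(fT _ _ Tt)//; exact: TDi Tt.
    * by rewrite D1F ?(gS _ _ Tt)//; exact: SDj Tt.
  + rewrite big_split_ord/=; congr sadd; apply: eq_bigr => i _.
    * by rewrite (unsplitK (inl i)).
    * by rewrite (unsplitK (inr i)).
- apply/uniform_mdistP => e e0; near=> k => t.
  have fke : forall t, D1 t -> mdist (f t) (fk k t) < e.
    by near: k; exact: fkf.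
  have gke : forall t, D2 t -> mdist (f t) (gk k t) < e.
    by near: k; exact: gkg.
  case=> Dt; first by rewrite mem_set//; exact: fke.
  by rewrite D1F//; exact: gke.
- apply/metricType_numDomainType.cvgrPdist_lt => e e0.
  have e20 : 0 < e / 2 by rewrite divr_gt0.
  near=> k.
  apply: (le_lt_trans (mdist_sadd _ _ _ _)); rewrite [ltRHS]splitr; apply: ltrD.
    by near: k; move/metricType_numDomainType.cvgrPdist_lt : vkv; exact.
  by near: k; move/metricType_numDomainType.cvgrPdist_lt : wkw; exact.
Unshelve. all: by end_near. Qed.

End Integral.
End LSpaceTheory.

(** * Moduli of continuity *)

Section Modulus.
Context {R : realType} (omega : R -> R).
Hypothesis omegaP : modulus_of_continuity omega.
Implicit Types s t e : R.

Lemma modulus_cvg0 : omega h @[h --> 0^'+] --> 0.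
Proof.
have := modulus_continuous omegaP => /continuous_within_itvcyP[_].
by rewrite (modulus0 omegaP).
Qed.

Lemma modulus_small e : 0 < e -> exists2 d, 0 < d &
  forall s, 0 <= s -> s <= d -> omega s < e.
Proof.
move=> e0; have /cvgrPdist_lt/(_ _ e0) := modulus_cvg0 => omegae.
near (0:R)^'+ => d; have d0 : 0 < d by near: d; exact: nbhs_right_gt.
exists d => // s s0 sd.
apply: (le_lt_trans (modulus_nondecreasing omegaP s0 sd)).
rewrite -[omega d]ger0_norm ?(modulus_ge0 omegaP (ltW d0))//.
rewrite -normrN -sub0r.
by near: d.
Unshelve. all: by end_near. Qed.

Lemma modulus_inv_near e : 0 < e -> \forall k \near \oo, omega k.+1%:R^-1 < e.
Proof.
move=> e0; have [d d0 de] := modulus_small e0.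
near=> k; apply: de; first by rewrite invr_ge0.
by apply/ltW; near: k; exact: (near_infty_natSinv_lt (PosNum d0)).
Unshelve. all: by end_near. Qed.

Lemma modulus_sub s t : 0 <= s -> 0 <= t -> omega s <= omega t + omega `|s - t|.
Proof.
move=> s0 t0.
apply: (le_trans _ (modulus_semiadditive omegaP t0 (normr_ge0 _))).
apply: (modulus_nondecreasing omegaP) => //.
by have := ler_norm (s - t); lra.
Qed.

Lemma modulus_dist s t : 0 <= s -> 0 <= t ->
  `|omega s - omega t| <= omega `|s - t|.
Proof.
move=> s0 t0; have := modulus_sub s0 t0; have := modulus_sub t0 s0.
by rewrite distrC => ? ?; rewrite ler_norml; lra.
Qed.

(* The bound [K * d * omega d] is [o(d)], so a function whose increments
   satisfy it cannot increase. *)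
Lemma modulus_increment_le0 (D : R -> R) (K T : R) : 0 <= T -> D 0 <= 0 ->
    (forall s d, 0 <= s -> 0 <= d -> s + d <= T ->
      D (s + d) <= D s + K * d * omega d) ->
  D T <= 0.
Proof.
move=> T0 D0 Dinc; wlog K0 : K Dinc / 0 < K.
  move=> /(_ (`|K| + 1)); apply; last by rewrite ltr_wpDl.
  move=> s d s0 d0 sdT; apply: (le_trans (Dinc _ _ s0 d0 sdT)).
  rewrite lerD2l; apply: ler_wpM2r; first exact: modulus_ge0.
  apply: ler_wpM2r => //; have := ler_norm K; lra.
apply/ler_addgt0Pr => e e0; rewrite add0r.
(* Cutting [[0, T]] into [N] steps of length [h <= d] accumulates at most [K * T * omega h], which
   this choice keeps below [e]. *)
have e10 : 0 < e / (K * (T + 1)) by rewrite divr_gt0// mulr_gt0// ltr_wpDl.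
have [d d0 de] := modulus_small e10.
pose N := (Num.truncn (T / d)).+1.
have N0 : 0 < N%:R :> R by rewrite ltr0n.
pose h := T / N%:R.
have h0 : 0 <= h by rewrite divr_ge0.
have hT : N%:R * h = T by rewrite /h mulrC divfK// gt_eqF.
have hd : h <= d.
  by rewrite ler_pdivrMr// mulrC -ler_pdivrMr//; apply/ltW/truncnS_gt.
have Dk k : (k <= N)%N -> D (k%:R * h) <= k%:R * (K * h * omega h).
  elim: k => [|k IH] kN; first by rewrite !mul0r.
  have kN' : k.+1%:R * h <= T by rewrite -hT ler_wpM2r// ler_nat.
  have := IH (ltnW kN); have := Dinc (k%:R * h) h.
  have -> : k%:R * h + h = k.+1%:R * h by rewrite -natr1 mulrDl mul1r.
  rewrite mulr_ge0// => /(_ isT h0 kN').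
  have -> : k.+1%:R * (K * h * omega h) =
    k%:R * (K * h * omega h) + K * h * omega h by rewrite -natr1 mulrDl mul1r.
  lra.
have := Dk N (leqnn _); rewrite hT mulrA (mulrCA N%:R) hT => DT.
apply: (le_trans DT); have := de h h0 hd; rewrite ltr_pdivlMr; last first.
  by rewrite mulr_gt0// ltr_wpDl.
have := modulus_ge0 omegaP h0; nra.
Qed.

Let mu := @lebesgue_measure R.
Definition modulus_integral (p : R) : R := \int[mu]_(u in `[0, p]) omega u.
Local Notation Omega := modulus_integral.

Lemma modulus_integrable s t : 0 <= s -> mu.-integrable `[s, t] (EFin \o omega).
Proof.
move=> s0; apply: continuous_compact_integrable; first exact: segment_compact.
apply: (continuous_subspaceW _ (modulus_continuous omegaP)) => x/=.
by rewrite !in_itv/= andbT => /andP[sx _]; exact: le_trans sx.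
Qed.

Lemma modulus_integral0 : Omega 0 = 0.
Proof. by rewrite /Omega set_itv1 Rintegral_set1. Qed.

(** Monotonicity puts [omega] between its values at the ends. By semi-additivity the two bounds
    differ by at most [(t - s) * omega (t - s)], which stands in for differentiating [Omega]. *)
Lemma modulus_integral_bounds s t : 0 <= s -> s <= t ->
  (t - s) * omega s <= Omega t - Omega s <= (t - s) * omega t.
Proof.
move=> s0 st; have t0 := le_trans s0 st.
rewrite /Omega Rintegral_itvB ?bnd_simp//; last exact: modulus_integrable.
rewrite Rintegral_itv_obnd_cbnd; last first.
  apply: integrableS (modulus_integrable t s0) => //; exact: subset_itv_oc_cc.
have fmu : fine (mu `[s, t]) = t - s.
  rewrite /mu lebesgue_measure_itv/= lte_fin.
  by case: ltgtP st => // -> _; rewrite subrr.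
have icst c : mu.-integrable `[s, t] (EFin \o cst c).
  by apply: continuous_compact_integrable;
    [exact: segment_compact|exact/continuous_subspaceT/cst_continuous].
rewrite -fmu ![fine _ * _]mulrC -!Rintegral_cst//.
apply/andP; split; apply: le_Rintegral => //;
  do ?[exact: modulus_integrable|exact: icst].
  move=> x /=; rewrite in_itv/= => /andP[sx _].
  exact: modulus_nondecreasing.
move=> x /=; rewrite in_itv/= => /andP[sx xt].
by apply: modulus_nondecreasing => //; exact: le_trans sx.
Qed.

Lemma modulus_integral_ge0 p : 0 <= p -> 0 <= Omega p.
Proof.
move=> p0; have := modulus_integral_bounds (lexx 0) p0.
by rewrite modulus_integral0 (modulus0 omegaP) mulr0 !subr0 => /andP[].
Qed.

(* The mean of a nondecreasing function over [0, p] increases with p. *)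
Lemma modulus_integral_superadditive p q : 0 <= p -> 0 <= q ->
  Omega p + Omega q <= Omega (p + q).
Proof.
(* This follows from [Omega s <= s * omega s] and [t * omega s <= Omega (s + t) - Omega s]. *)
have mean s t : 0 <= s -> 0 <= t -> (s + t) * Omega s <= s * Omega (s + t).
  move=> s0 t0.
  have /andP[_] := modulus_integral_bounds (lexx 0) s0.
  rewrite modulus_integral0 !subr0 => h1.
  have st : s <= s + t by lra.
  have /andP[+ _] := modulus_integral_bounds s0 st.
  have -> : s + t - s = t by lra.
  move=> h2; nra.
move=> p0 q0; have := mean p q p0 q0; have := mean q p q0 p0.
rewrite [q + p]addrC => h1 h2.
(* The sum of [h1] and [h2] is the claim multiplied by [p + q], so the case [p + q = 0] is
   separate. *)
have [pq0|pq0] := eqVneq (p + q) 0.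
  have -> : p = 0 by lra.
  have -> : q = 0 by lra.
  by rewrite addr0 modulus_integral0 addr0.
have {}pq0 : 0 < p + q by rewrite lt_neqAle eq_sym pq0 addr_ge0.
by rewrite -(ler_pM2l pq0); lra.
Qed.

End Modulus.

(** * Primitives and their Hukuhara derivatives *)

Section Primitive.
Context {R : realType} {X : lspaceType R} (P : X -> X) (omega : R -> R).
Hypotheses (convP : convexifying P) (omegaP : modulus_of_continuity omega).
Variables (a b : R) (phi : R -> X).
Hypothesis phiH : Homega omega a b phi.
Local Notation cmu := (@completed_lebesgue_measure R).
Local Notation J := (fun s t : R => lintegral P `[s, t] phi).
Implicit Types (s t r x : R).

(** [phi] is sampled at the left ends of a grid of mesh [N^-1] starting at [s]; a point of [[s, t]]
    lies within [N^-1] of its sample. *)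
Lemma Homega_step_approx s t (N : R) : 0 < N -> a <= s -> t <= b ->
  exists fk v, is_simple_integral P `[s, t] fk v /\
    forall x, x \in `[s, t] -> mdist (phi x) (fk x) <= omega N^-1.
Proof.
move=> N0 sa tb.
pose i_ x := Num.truncn ((x - s) * N).
(* The cell of [t] itself has index [i_ t], hence the successor. *)
pose M := (i_ t).+1.
pose T (i : 'I_M) : set (@lebesgueTypeR R) :=
  [set x | x \in `[s, t] /\ i_ x = i].
pose fk x := phi (s + (i_ x)%:R / N).
exists fk,
  (\big[sadd/theta]_(i < M) (fine (cmu (T i)) *.: P (phi (s + i%:R / N)))).
have i_itv x : s <= x -> 0 <= x - (s + (i_ x)%:R / N) <= N^-1.
  move=> sx; have xs0 : 0 <= (x - s) * N by rewrite mulr_ge0// ?subr_ge0// ltW.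
  have /andP[h1 h2] := truncn_itv xs0.
  have : (i_ x)%:R / N <= x - s by rewrite ler_pdivrMr.
  have : x - s <= (i_ x)%:R / N + N^-1.
    have -> : (i_ x)%:R / N + N^-1 = (i_ x).+1%:R / N.
      by rewrite -natr1 mulrDl mul1r.
    by rewrite ler_pdivlMr// ltW.
  by move=> h3 h4; rewrite opprD addrA subr_ge0 h4 lerBlDl h3.
split.
  exists M, (fun i => phi (s + i%:R / N)), T; split => //.
  - move=> i; have -> : T i = `[s, t] `&` `[s + i%:R / N, s + i.+1%:R / N[.
      apply/seteqP; split => x /= [xst].
        have /andP[sx xt] : s <= x <= t by rewrite in_itv in xst.
        have xs0 : 0 <= (x - s) * N by rewrite mulr_ge0// ?subr_ge0// ltW.
        move=> /eqP; rewrite truncn_eq// => xi; split => //; rewrite in_itv/=.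
        by rewrite -lerBrDl -ltrBlDl ler_pdivrMr// ltr_pdivlMr.
      have /andP[sx xt] : s <= x <= t by rewrite in_itv in xst.
      have xs0 : 0 <= (x - s) * N by rewrite mulr_ge0// ?subr_ge0// ltW.
      rewrite in_itv/= -lerBrDl -ltrBlDl ler_pdivrMr// ltr_pdivlMr// => xi.
      by split => //; apply/eqP; rewrite truncn_eq.
    by apply: measurableI; exact: lebesgueTypeR_measurable_itv.
  - apply/trivIsetP => i j _ _ ij; rewrite -subset0 => x [[_ xi] [_ xj]].
    by move/eqP : ij; apply; apply: val_inj; rewrite /= -xi.
  - apply/seteqP; split => [x [i _ []]//|x xst].
    have /andP[sx xt] : s <= x <= t by move: xst; rewrite /= in_itv.
    have iM : (i_ x < M)%N.
      by rewrite ltnS; apply: le_truncn; apply: ler_wpM2r;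
        [exact: ltW|rewrite lerD2r].
    by exists (Ordinal iM).
  - by move=> i x [_ xi]; rewrite /fk xi.
move=> x; rewrite /= in_itv/= => /andP[sx xt].
have /andP[d0 dN] := i_itv x sx.
have i0 : 0 <= (i_ x)%:R / N by rewrite divr_ge0// ltW.
apply: (le_trans (phiH _ _)); first by rewrite in_itv/=; lra.
  by rewrite in_itv/=; lra.
rewrite ger0_norm//; exact: modulus_nondecreasing.
Qed.

(** The integrals of the step approximations of mesh [k.+1%:R^-1] form a Cauchy sequence, and
    completeness of [X] supplies the limit. Hence [lintegral] takes no junk value on subintervals of
    [[a, b]]. *)
Lemma Homega_integral s t : a <= s -> s <= t -> t <= b ->
  is_integral P `[s, t] phi (J s t).
Proof.
move=> sa st tb; suff [v fv] : exists v, is_integral P `[s, t] phi v.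
  exact: (xgetI _ fv).
have /choice[fk /choice[vk fvk]] :=
  fun k => Homega_step_approx (ltr0Sn R k) sa tb.
have mst := lebesgueTypeR_measurable_itv `[s, t].
have fst : cmu `[s, t] \is a fin_num by rewrite completed_lebesgue_measure_cc.
have vkl i j :
    mdist (vk i) (vk j) <= (t - s) * (omega i.+1%:R^-1 + omega j.+1%:R^-1).
  rewrite -[t - s]/(fine (t - s)%:E) -completed_lebesgue_measure_cc//.
  apply: (simple_integral_dist convP mst fst (fvk i).1 (fvk j).1) => x xst.
  apply: (le_trans (metric_triangle _ (phi x) _)); apply: lerD.
    by rewrite metric_sym; exact: (fvk i).2.
  exact: (fvk j).2.
have : cvg (vk @ \oo).
  apply: cauchy_cvg; apply: cauchy_exP => e e0.
  have e10 : 0 < e / (2 * (t - s + 1)).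
    by rewrite divr_gt0// mulr_gt0// ltr_wpDl// subr_ge0.
  have [n _ ne] := modulus_inv_near omegaP e10.
  exists (vk n), n => // m /= nm; rewrite ballEmdist/=.
  apply: (le_lt_trans (vkl _ _)).
  have := ne n (leqnn n); have := ne m nm.
  have eE : e = 2 * (t - s + 1) * (e / (2 * (t - s + 1))).
    by field; rewrite gt_eqF// ltr_wpDl// subr_ge0.
  move: (e / _) eE e10 => e1 -> e10 /= m1 n1.
  have : 0 <= t - s by rewrite subr_ge0.
  nra.
move=> /cvg_ex[v vkv]; exists v, fk, vk; split => //.
  by move=> k; exact: (fvk k).1.
apply/uniform_mdistP => e e0; have [n _ ne] := modulus_inv_near omegaP e0.
exists n => // m nm x xst; apply: le_lt_trans (ne m nm); exact: (fvk m).2.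
Qed.

Lemma lintegral_dist_cst s t (c : X) eps : a <= s -> s <= t -> t <= b ->
    (forall x, s <= x <= t -> mdist (phi x) c <= eps) ->
  mdist (J s t) ((t - s) *.: P c) <= (t - s) * eps.
Proof.
move=> sa st tb phic; have mst := lebesgueTypeR_measurable_itv `[s, t].
rewrite -[t - s]/(fine (t - s)%:E) -completed_lebesgue_measure_cc//.
apply: (@integral_dist _ _ _ convP _ phi (cst c)) => //.
- by rewrite completed_lebesgue_measure_cc.
- exact: Homega_integral.
- exact: is_integral_cst.
Qed.

(** Deleting the null set [[set r]] from the left interval makes the two intervals disjoint. *)
Lemma lintegral_add s r t : a <= s -> s <= r -> r <= t -> t <= b ->
  J s t = J s r +.: J r t.
Proof.
move=> sa sr rt tb; have st := le_trans sr rt.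
apply: lintegralE => //; first exact: lebesgueTypeR_measurable_itv.
  by rewrite completed_lebesgue_measure_cc.
have -> : `[s, t]%classic = (`[s, r] `\` [set r]) `|` `[r, t].
  apply/seteqP; split => x /=; rewrite !in_itv/=.
    move=> /andP[sx xt]; have [xr|xr|->] := ltgtP x r.
    - by left; split; [lra|apply/eqP; lra].
    - by right; lra.
    - by right; lra.
  by case=> [[]|]; lra.
apply: is_integral_setU.
- apply/disj_setPS => x /= [[]]; rewrite !in_itv/= => xr /eqP xNr rx.
  by move: xNr; lra.
- apply: is_integral_null.
  + by rewrite -set_itv1; exact: lebesgueTypeR_measurable_itv.
  + by rewrite -set_itv1 completed_lebesgue_measure_cc// subrr.
  + exact: lebesgueTypeR_measurable_itv.
  + by apply: Homega_integral => //; exact: le_trans rt tb.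
- by apply: Homega_integral => //; exact: le_trans sr.
Qed.

Lemma lintegral_point s : a <= s -> s <= b -> J s s = theta.
Proof.
move=> sa sb; apply: mdist_positivity; apply/eqP; rewrite eq_le mdist_ge0 andbT.
have := @lintegral_dist_cst s s (phi s) 0 sa (lexx s) sb.
rewrite subrr sscale0 mul0r; apply => x.
by rewrite -eq_le => /eqP ->; rewrite mdistxx.
Qed.

End Primitive.

(** * Comparison of primitives with linear curves, and their Hukuhara type derivative *)

Section Derivative.
Context {R : realType} {X : lspaceType R} (P : X -> X) (omega : R -> R).
Hypotheses (isoX : isotropic X) (convP : convexifying P).
Hypothesis omegaP : modulus_of_continuity omega.
Local Notation Omega := (modulus_integral omega).
Implicit Types (s t d x : R).

(** Addition is nonexpansive, so [mdist (F x) (G x) - h x] grows over a step [d] by at most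
    [K * d * omega d], and therefore stays nonpositive. *)
Lemma increment_dist_le (F G : R -> X) (h : R -> R) (K T : R) : 0 <= T ->
    mdist (F 0) (G 0) <= h 0 ->
    (forall s d, 0 <= s -> 0 <= d -> s + d <= T -> exists z w,
      [/\ F (s + d) = F s +.: z, G (s + d) = G s +.: w &
          mdist z w <= h (s + d) - h s + K * d * omega d]) ->
  mdist (F T) (G T) <= h T.
Proof.
move=> T0 FG0 inc; rewrite -subr_le0.
apply: (modulus_increment_le0 omegaP (D := fun x => mdist (F x) (G x) - h x)
  (K := K) T0); first by rewrite subr_le0.
move=> s d s0 d0 sdT; have [z [w [-> -> zw]]] := inc s d s0 d0 sdT.
have := mdist_sadd (F s) z (G s) w; lra.
Qed.

Variables (a b : R) (phi : R -> X).
Hypothesis phiH : Homega omega a b phi.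
Local Notation J := (fun s t : R => lintegral P `[s, t] phi).

Lemma lintegral_dist_near s t c (d : R) : a <= s -> s <= t -> t <= b ->
    a <= c <= b -> 0 <= d -> (forall x, s <= x <= t -> `|x - c| <= d) ->
  mdist (J s t) ((t - s) *.: P (phi c)) <= (t - s) * omega d.
Proof.
move=> sa st tb acb d0 cd; apply: (lintegral_dist_cst convP omegaP phiH) => //.
move=> x xst; apply: (le_trans (phiH _ _)); rewrite ?in_itv//=.
  by move: xst => /andP[sx xt]; rewrite (le_trans sa sx) (le_trans xt tb).
by apply: (modulus_nondecreasing omegaP) => //; exact: cd.
Qed.

(** On [[c + s, c + s + d]] the mapping [phi] is within [omega (s + d)] of [phi c], and
    semi-additivity gives [d * omega (s + d) <= Omega (s + d) - Omega s + d * omega d]. *)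
Lemma lintegral_dist_right c T : a <= c -> 0 <= T -> c + T <= b ->
  mdist (J c (c + T)) (T *.: P (phi c)) <= Omega T.
Proof.
move=> ac T0 cTb.
apply: (increment_dist_le (F := fun x => J c (c + x))
  (G := fun x => x *.: P (phi c)) (K := 1)) => //.
  rewrite addr0 (lintegral_point convP omegaP phiH)//; last lra.
  by rewrite sscale0 mdistxx modulus_integral0.
move=> s d s0 d0 sdT.
exists (J (c + s) (c + (s + d))), (d *.: P (phi c)); split.
- by apply: (lintegral_add convP omegaP phiH) => //; lra.
- by rewrite (convexifying_convex convP).
- have := @lintegral_dist_near (c + s) (c + (s + d)) c (s + d).
  have -> : c + (s + d) - (c + s) = d by ring.
  move=> /(_ _ _ _ _ _ _)/le_trans; apply; do ?lra.
    by move=> x /andP[csx xsd]; rewrite ger0_norm; lra.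
  have sd : s <= s + d by lra.
  have /andP[+ _] := modulus_integral_bounds omegaP s0 sd.
  have -> : s + d - s = d by ring.
  have := modulus_semiadditive omegaP s0 d0; nra.
Qed.

(** Mirror image of [lintegral_dist_right]: the interval grows at its left end, so [saddC] is needed
    to put the new piece last. *)
Lemma lintegral_dist_left c T : c <= b -> 0 <= T -> a <= c - T ->
  mdist (J (c - T) c) (T *.: P (phi c)) <= Omega T.
Proof.
move=> cb T0 acT.
apply: (increment_dist_le (F := fun x => J (c - x) c)
  (G := fun x => x *.: P (phi c)) (K := 1)) => //.
  rewrite subr0 (lintegral_point convP omegaP phiH)//; last lra.
  by rewrite sscale0 mdistxx modulus_integral0.
move=> s d s0 d0 sdT.
exists (J (c - (s + d)) (c - s)), (d *.: P (phi c)); split.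
- by rewrite saddC; apply: (lintegral_add convP omegaP phiH) => //; lra.
- by rewrite (convexifying_convex convP).
- have := @lintegral_dist_near (c - (s + d)) (c - s) c (s + d).
  have -> : c - s - (c - (s + d)) = d by ring.
  move=> /(_ _ _ _ _ _ _)/le_trans; apply; do ?lra.
    by move=> x /andP[csx xsd]; rewrite ler0_norm; lra.
  have sd : s <= s + d by lra.
  have /andP[+ _] := modulus_integral_bounds omegaP s0 sd.
  have -> : s + d - s = d by ring.
  have := modulus_semiadditive omegaP s0 d0; nra.
Qed.

Lemma mean_dist s t u : a <= s -> s <= t -> t <= u -> u <= b -> s < u ->
  mdist (P (phi t)) ((u - s)^-1 *.: J s u) <= (u - s)^-1 * Omega (u - s).
Proof.
move=> sa st tu ub su; have us0 : 0 < u - s by rewrite subr_gt0.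
(* Writing [P (phi t)] as [(u - s)^-1 *.: ((u - s) *.: P (phi t))] lets the common scalar leave the
   distance. *)
rewrite -[X in mdist X](sscale1 (P (phi t))) -(mulVf (lt0r_neq0 us0)) -sscaleA.
rewrite mdist_sscale gtr0_norm ?invr_gt0//.
apply: ler_wpM2l; first by rewrite invr_ge0 ltW.
have st0 : 0 <= t - s by rewrite subr_ge0.
have tu0 : 0 <= u - t by rewrite subr_ge0.
rewrite metric_sym (lintegral_add convP omegaP phiH sa st tu ub).
have -> : u - s = (t - s) + (u - t) by ring.
(* Convexity of [P (phi t)] splits the linear term at [t], matching the split of the integral. *)
rewrite (convexifying_convex convP)//.
apply: (le_trans (mdist_sadd _ _ _ _)).
apply: le_trans (modulus_integral_superadditive omegaP st0 tu0).
apply: lerD.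
  have := @lintegral_dist_left t (t - s); rewrite subKr; apply => //.
  exact: le_trans ub.
have := @lintegral_dist_right t (u - t); rewrite subrKC; apply => //.
exact: le_trans st.
Qed.

Variables (f : R -> X) (x0 : X).
Hypothesis ab : a < b.
Hypothesis fE : {in `[a, b], forall t, f t = x0 +.: J a t}.

(** Provides [J s t] as a witness that the Hukuhara type difference of [f t] and [f s] exists. *)
Lemma W1Homega_increment s t : a <= s -> s <= t -> t <= b ->
  f t = f s +.: J s t.
Proof.
move=> sa st tb; rewrite !fE ?in_itv/= ?sa ?(le_trans st tb)// -?saddA.
  by rewrite (lintegral_add convP omegaP phiH (lexx a) sa st tb).
by rewrite tb (le_trans sa st).
Qed.

Lemma W1Homega_hdiff s t : a <= s -> s <= t -> t <= b ->
  hdiff (f t) (f s) = J s t.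
Proof.
by move=> sa st tb; rewrite (W1Homega_increment sa st tb) hdiff_saddl.
Qed.

Lemma difference_quotient_dist s t c d : a <= s -> t <= b -> s <= c <= t ->
  0 < d -> t - s = d ->
  mdist (P (phi c)) (d^-1 *.: J s t) <= omega d.
Proof.
move=> sa tb sct d0 tsd.
rewrite -[X in mdist X](sscale1 (P (phi c))) -(mulVf (lt0r_neq0 d0)) -sscaleA.
rewrite mdist_sscale gtr0_norm ?invr_gt0// ler_pdivrMl// metric_sym -tsd.
apply: lintegral_dist_near => //; do ?lra.
by move=> x sxt; rewrite ler_norml; lra.
Qed.

Lemma cvg_modulus_dist (T : R -> X) (p : X) (e : R) : 0 < e ->
    (forall h, 0 < h -> h < e -> mdist p (T h) <= omega h) ->
  T h @[h --> 0^'+] --> p.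
Proof.
move=> e0 Tp; apply/metricType_numDomainType.cvgrPdist_lt => d d0.
have [r r0 rd] := modulus_small omegaP d0.
near=> h; have h0 : 0 < h by near: h; exact: nbhs_right_gt.
apply: (le_lt_trans (Tp h h0 _)); first by near: h; exact: nbhs_right_lt.
by apply: rd; [exact: ltW|near: h; exact: nbhs_right_le].
Unshelve. all: by end_near. Qed.

Lemma is_hderiv_W1Homega t : a <= t <= b -> is_hderiv a b f t (P (phi t)).
Proof.
move=> /andP[ta tb]; split => [tb'|ta'].
  have bt0 : 0 < b - t by rewrite subr_gt0.
  split.
    near=> h; exists (J t (t + h)).
    have h0 : 0 < h by near: h; exact: nbhs_right_gt.
    have hb : h < b - t by near: h; exact: nbhs_right_lt.
    by apply: W1Homega_increment; lra.
  apply: (cvg_modulus_dist bt0) => h h0 hb.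
  rewrite W1Homega_hdiff//; do ?lra.
  by apply: difference_quotient_dist => //; lra.
have at0 : 0 < t - a by rewrite subr_gt0.
split.
  near=> h; exists (J (t - h) t).
  have h0 : 0 < h by near: h; exact: nbhs_right_gt.
  have hb : h < t - a by near: h; exact: nbhs_right_lt.
  by apply: W1Homega_increment; lra.
apply: (cvg_modulus_dist at0) => h h0 hb.
rewrite W1Homega_hdiff//; do ?lra.
by apply: difference_quotient_dist => //; lra.
Unshelve. all: by end_near. Qed.

Lemma hderiv_W1Homega t : a <= t <= b -> hderiv a b f t = P (phi t).
Proof.
move=> atb; have [rd ld] := is_hderiv_W1Homega atb.
apply: xget_unique => [|p [rp lp]]; first exact: is_hderiv_W1Homega.
(* One one-sided limit already determines the derivative: the right one if [t < b], otherwise the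
   left one, available because [a < b <= t]. *)
have [tb|bt] := ltP t b.
  have [_ fp] := rp tb; have [_ fd] := rd tb.
  exact: (@cvg_unique _ (@metric_hausdorff _ X) _ _ _ _ fp fd).
have ta : a < t by exact: lt_le_trans bt.
have [_ fp] := lp ta; have [_ fd] := ld ta.
exact: (@cvg_unique _ (@metric_hausdorff _ X) _ _ _ _ fp fd).
Qed.

End Derivative.

(** * Extremal functions *)

Section IsometricLine.
Context {R : realType} {X : lspaceType R}.
Hypothesis isoX : isotropic X.

Lemma isometric_line :
    invertible_elements X `&` convex_elements X <> [set theta] ->
  exists L : R -> X, [/\ forall r s, L (r + s) = L r +.: L s,
    forall r s, mdist (L r) (L s) = `|r - s|,
    forall d r, 0 <= d -> d *.: L r = L (d * r) &
    forall r, convex_elements X (L r)].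
Proof.
move=> inv_conv.
(* [theta] is both invertible and convex, so an intersection other than [[set theta]] contains a
   nonzero element. *)
have [v [[v' vv'] cv] v0] :
    exists2 v, (invertible_elements X `&` convex_elements X) v & v != theta.
  apply: contrapT => noV; apply: inv_conv; apply/seteqP; split => x /=.
    by move=> xV; apply: contrapT => /eqP x0; apply: noV; exists x.
  move=> ->; split; first by exists theta; rewrite sadd0.
  by move=> al be _ _; rewrite !sscale_theta sadd0.
pose c := mdist v theta; have c0 : 0 < c by rewrite mdist_gt0.
have cc0 : c != 0 by rewrite gt_eqF.
(* Adding [v] to both points turns the pair [v'], [theta] into [theta], [v]. *)
have c'E : mdist v' theta = c.
  by rewrite -(isoX v' theta v) sadd0l saddC vv' metric_sym.
(* The scalar [-1] need not invert [v]: on the real line, [al *.: x = |al| x] satisfies the axioms.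
   Negative arguments therefore use the inverse [v']. *)
pose l r := if 0 <= r then r *.: v else (- r) *.: v'.
have lM d r : 0 <= d -> d *.: l r = l (d * r).
  rewrite le_eqVlt => /predU1P[<-|d0].
    by rewrite sscale0 mul0r /l lexx sscale0.
  rewrite /l pmulr_rge0//; case: ifP => _; rewrite sscaleA//.
  by rewrite mulrN.
(* On shifting by a large multiple of [v], [l] becomes multiplication by
   nonnegative scalars, where convexity of [v] applies. *)
have lS r s : 0 <= s -> 0 <= r + s -> l r +.: s *.: v = (r + s) *.: v.
  move=> s0 rs0; rewrite /l; case: ifPn => [r0|]; first by rewrite cv.
  rewrite -ltNge => r0; have -> : s = - r + (r + s) by ring.
  rewrite cv ?oppr_ge0 ?(ltW r0)// saddA -sscaleDr (saddC v') vv' sscale_theta.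
  by rewrite sadd0l; congr (_ *.: _); ring.
have lD r s : l (r + s) = l r +.: l s.
  apply: (@isotropic_saddI _ _ isoX ((`|r| + `|s|) *.: v)).
  have rr : 0 <= r + `|r| by have := ler_norm (- r); rewrite normrN; lra.
  have ss : 0 <= s + `|s| by have := ler_norm (- s); rewrite normrN; lra.
  have rs0 : 0 <= `|r| + `|s| by rewrite addr_ge0.
  rewrite saddC lS//; last by move: `|r| `|s| rr ss => *; lra.
  transitivity ((r + `|r|) *.: v +.: (s + `|s|) *.: v).
    by rewrite -cv//; congr (_ *.: _); ring.
  by rewrite -(lS r)// -(lS s)// cv// Monoid.mulmACA saddC.
have l0 : l 0 = theta by rewrite /l lexx sscale0.
have ln r : mdist (l r) theta = `|r| * c.
  rewrite /l; case: ifPn => [r0|].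
    by rewrite -[X in mdist _ X](sscale_theta r) mdist_sscale.
  by move=> r0; rewrite -[X in mdist _ X](sscale_theta (- r)) mdist_sscale
    normrN c'E.
have ld r s : mdist (l r) (l s) = `|r - s| * c.
  rewrite -{1}(subrK s r) lD -{2}[l s]sadd0l isoX; exact: ln.
(* Dividing by [c], the distance from [v] to [theta], turns [l] into an isometry. *)
exists (fun r => l (r / c)); split.
- by move=> r s; rewrite mulrDl lD.
- move=> r s; rewrite ld -mulrBl normrM (gtr0_norm (x := c^-1)) ?invr_gt0//.
  by rewrite divfK.
- by move=> d r d0; rewrite lM// mulrA.
- move=> r al be al0 be0.
  by rewrite !lM ?addr_ge0// mulrDl lD.
Qed.

End IsometricLine.

(** * Distance to the nodes of even index *)

Section DistanceToLattice.
Context {R : realType} (h : R).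
Hypothesis h0 : 0 <= h.
Implicit Types (x y z : R) (m i : nat).

(* The distance from [y] to the set {0, 2 h, ..., 2 m h}. *)
Fixpoint even_node_dist m y : R := if m is m'.+1 then
  Num.min (even_node_dist m' y) `|y - m%:R * (2 * h)| else `|y|.

Lemma even_node_dist_ge0 m y : 0 <= even_node_dist m y.
Proof. by elim: m => [|m IH] //=; rewrite le_min IH /=. Qed.

Lemma even_node_dist_lip m y z :
  `|even_node_dist m y - even_node_dist m z| <= `|y - z|.
Proof.
elim: m => [|m IH]; first exact: ler_dist_dist.
rewrite [even_node_dist _ _]/= [even_node_dist _ z]/=.
have := ler_dist_dist (y - m.+1%:R * (2 * h)) (z - m.+1%:R * (2 * h)).
have -> : y - m.+1%:R * (2 * h) - (z - m.+1%:R * (2 * h)) = y - z by ring.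
move: IH; move: (even_node_dist m y) (even_node_dist m z) => p q.
move: `|y - _| `|z - _| `|y - z| => p' q' w.
rewrite !ler_norml => /andP[? ?] /andP[? ?].
by case: (leP p p') => ?; case: (leP q q') => ?; lra.
Qed.

Lemma even_node_dist_le m i y : (i <= m)%N ->
  even_node_dist m y <= `|y - i%:R * (2 * h)|.
Proof.
elim: m => [|m IH]; first by rewrite leqn0 => /eqP ->; rewrite mul0r subr0.
rewrite leq_eqVlt => /predU1P[->|im] /=; first by rewrite ge_min lexx orbT.
by rewrite ge_min IH.
Qed.

Lemma le_even_node_dist m v y :
  (forall i, (i <= m)%N -> v <= `|y - i%:R * (2 * h)|) ->
  v <= even_node_dist m y.
Proof.
elim: m => [|m IH] vy; first by have := vy 0 (leqnn _); rewrite mul0r subr0.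
rewrite /= le_min vy// andbT; apply: IH => i im; apply: vy.
exact: leq_trans im _.
Qed.

(** Distinct even nodes are at least [2 * h] apart, so a point within [h] of one of them is at
    distance at least [h] from all the others. *)
Lemma even_node_distE m i x : (i <= m)%N -> `|x| <= h ->
  even_node_dist m (i%:R * (2 * h) + x) = `|x|.
Proof.
move=> im xh; apply/eqP; rewrite eq_le; apply/andP; split.
  by apply: (le_trans (even_node_dist_le _ im)); rewrite addrAC subrr add0r.
apply: le_even_node_dist => j _.
have [<-|ij] := eqVneq i j; first by rewrite addrAC subrr add0r.
have hij : 2 * h <= `|i%:R * (2 * h) - j%:R * (2 * h)|.
  rewrite -mulrBl normrM (ger0_norm (x := 2 * h)) ?mulr_ge0//.
  rewrite ler_peMl ?mulr_ge0//.
  wlog : i j {im} ij / (i < j)%N.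
    move=> H; move: (ij); rewrite neq_ltn => /orP[|] ?; first exact: H.
    by rewrite distrC; apply: H; rewrite // eq_sym.
  by move=> {}ij; rewrite distrC -natrB ?(ltnW ij)// normr_nat ler1n subn_gt0.
have := ler_normB (i%:R * (2 * h) + x - j%:R * (2 * h)) x.
have -> : i%:R * (2 * h) + x - j%:R * (2 * h) - x =
  i%:R * (2 * h) - j%:R * (2 * h) by ring.
lra.
Qed.

End DistanceToLattice.

(** * The two extremal primitives *)

Section Extremal.
Context {R : realType} {X : lspaceType R} (P : X -> X) (omega : R -> R).
Hypotheses (isoX : isotropic X) (convP : convexifying P).
Hypothesis omegaP : modulus_of_continuity omega.
Local Notation Omega := (modulus_integral omega).
Variables (L : R -> X).
Hypotheses (LD : forall r s, L (r + s) = L r +.: L s)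
  (L_dist : forall r s, mdist (L r) (L s) = `|r - s|)
  (LM : forall d r, 0 <= d -> d *.: L r = L (d * r))
  (L_convex : forall r, convex_elements X (L r)).
Variables (a b : R) (n : nat) (sg : R).
Hypotheses (ab : a < b) (n_gt0 : (0 < n)%N) (sg1 : `|sg| = 1).
Implicit Types (s d p q c : R).

Variables (h e : R).
Hypotheses (h_gt0 : 0 < h) (nhE : n%:R * h = b - a) (ehE : e * h = Omega h).

Let h_ge0 : 0 <= h. Proof. exact: ltW. Qed.

(** By [ehE], [e] is the mean of [omega] over [[0, h]]; subtracting it makes the integral over each
    cell vanish. The sign [sg] selects one of two opposite functions. *)
Definition extremal (s : R) : X :=
  L (sg * (omega (even_node_dist h n (s - a)) - e)).

Local Notation J := (fun s t : R => lintegral P `[s, t] extremal).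

Lemma isometric_line0 : L 0 = theta.
Proof. by rewrite -(mul0r 0) -LM// sscale0. Qed.

Lemma extremal_Homega : Homega omega a b extremal.
Proof.
move=> s t _ _; rewrite /extremal L_dist -mulrBr normrM sg1 mul1r.
rewrite opprB addrA subrK.
apply: (le_trans (modulus_dist omegaP _ _)); do ?exact: even_node_dist_ge0.
apply: (modulus_nondecreasing omegaP) => //.
apply: (le_trans (even_node_dist_lip _ _ _ _)).
by rewrite opprB addrA subrK.
Qed.

(** The primitive of [sg * (omega s - e)]. [L (G s)] is the expected integral of [extremal] over the
    interval of length [s], at most [h], on either side of an even node. *)
Let G s : R := sg * (Omega s - e * s).

(** Both sides are compared with [d *.: P (extremal c)], each within [d * omega d]. The point [c] is
    left free so that it can be either end of [[p, q]]. *)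
Lemma extremal_increment p q c s d : a <= p -> p <= c -> c <= q -> q <= b ->
    0 <= s -> q - p = d -> even_node_dist h n (c - a) = s ->
  mdist (J p q) (L (G (s + d) - G s)) <= 2 * d * omega d.
Proof.
move=> ap pc cq qb s0 qpd cs.
have d0 : 0 <= d by rewrite -qpd; lra.
apply: (le_trans (metric_triangle _ (d *.: P (extremal c)) _)).
have -> : 2 * d * omega d = d * omega d + d * omega d by ring.
apply: lerD.
  have := lintegral_dist_near convP omegaP extremal_Homega (s := p) (t := q)
    (c := c) (d := d).
  rewrite qpd; apply; rewrite ?(le_trans ap pc) ?(le_trans cq qb)//.
    exact: le_trans cq.
  by move=> x /andP[px xq]; rewrite ler_norml; apply/andP; split; lra.
rewrite (convexifying_fixed convP)//; last exact: L_convex.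
rewrite /extremal LM// L_dist cs /G -mulrBr mulrCA -mulrBr normrM sg1 mul1r.
have sd : s <= s + d by lra.
have /andP[+ +] := modulus_integral_bounds omegaP s0 sd.
have -> : s + d - s = d by ring.
have := modulus_semiadditive omegaP s0 d0.
rewrite ler_norml => ? ? ?; nra.
Qed.

Let Gh : G h = 0.
Proof. by rewrite /G ehE subrr mulr0. Qed.

Let LGh : L (G h) = theta. Proof. by rewrite Gh isometric_line0. Qed.

Let G0 : G 0 = 0.
Proof. by rewrite /G modulus_integral0 mulr0 subrr mulr0. Qed.

Lemma extremal_lintegral_right i c : (i <= n)%N ->
    c = a + i%:R * (2 * h) -> c + h <= b ->
  J c (c + h) = theta.
Proof.
move=> iN cE chb; apply: mdist_positivity; apply/eqP.
have ac : a <= c by rewrite cE lerDl mulr_ge0// mulr_ge0.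
have h0 := h_gt0.
rewrite eq_le mdist_ge0 andbT -LGh.
(* With the bound [fun=> 0] the comparison forces [J c (c + x)] and [L (G x)] to agree at [x = h],
   where the latter is [theta]. *)
apply: (increment_dist_le omegaP (F := fun x => J c (c + x))
  (G := fun x => L (G x)) (h := fun=> 0) (K := 2)) => //.
  rewrite addr0 (lintegral_point convP omegaP extremal_Homega)//; last lra.
  by rewrite G0 isometric_line0 mdistxx.
move=> s d s0 d0 sdh.
exists (J (c + s) (c + (s + d))), (L (G (s + d) - G s)); split.
- by apply: (lintegral_add convP omegaP extremal_Homega); lra.
- by rewrite -LD subrKC.
- rewrite subrr add0r; apply: (@extremal_increment _ _ (c + s)) => //; try lra.
  have -> : c + s - a = i%:R * (2 * h) + s by rewrite cE; ring.
  by rewrite even_node_distE// ger0_norm//; lra.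
Qed.

(** Mirror image of [extremal_lintegral_right]: the reference point [c - s] is now the right end of
    each increment. *)
Lemma extremal_lintegral_left i c : (i <= n)%N ->
    c = a + i%:R * (2 * h) -> a <= c - h -> c <= b ->
  J (c - h) c = theta.
Proof.
move=> iN cE ach cb; apply: mdist_positivity; apply/eqP.
have h0 := h_gt0.
rewrite eq_le mdist_ge0 andbT -LGh.
apply: (increment_dist_le omegaP (F := fun x => J (c - x) c)
  (G := fun x => L (G x)) (h := fun=> 0) (K := 2)) => //.
  rewrite subr0 (lintegral_point convP omegaP extremal_Homega)//; last lra.
  by rewrite G0 isometric_line0 mdistxx.
move=> s d s0 d0 sdh.
exists (J (c - (s + d)) (c - s)), (L (G (s + d) - G s)); split.
- by rewrite saddC; apply: (lintegral_add convP omegaP extremal_Homega); lra.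
- by rewrite -LD subrKC.
- rewrite subrr add0r; apply: (@extremal_increment _ _ (c - s)) => //; try lra.
  have -> : c - s - a = i%:R * (2 * h) + - s by rewrite cE; ring.
  by rewrite even_node_distE// ?normrN ger0_norm//; lra.
Qed.

Lemma extremal_lintegral_node k : (k <= n)%N -> J a (a + k%:R * h) = theta.
Proof.
elim: k => [_|k IH kn].
  rewrite mul0r addr0.
  by rewrite (lintegral_point convP omegaP extremal_Homega)//; exact: ltW.
have kb m : (m <= n)%N -> a + m%:R * h <= b.
  by move=> mn; rewrite -lerBrDl -nhE ler_wpM2r// ler_nat.
have ak m : a <= a + m%:R * h by rewrite lerDl mulr_ge0.
have kS : a + k%:R * h <= a + k.+1%:R * h.
  by rewrite lerD2l ler_wpM2r// ler_nat.
rewrite (lintegral_add convP omegaP extremal_Homega (lexx a) (ak k) kS)//;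
  last exact: kb.
rewrite IH ?(ltnW kn)// sadd0l.
have hS m : a + m.+1%:R * h = a + m%:R * h + h by rewrite -natr1; ring.
have h2 m : a + m.*2%:R * h = a + m%:R * (2 * h).
  by rewrite -muln2 natrM mulrA.
(* Each cell has exactly one end of even index: its right end when [k] is odd, its left end when [k]
   is even. *)
have := odd_double_half k; have [ko|ke] := boolP (odd k) => kE.
  have kE' : k.+1 = k./2.+1.*2 by rewrite doubleS -[in LHS]kE.
  have -> : a + k%:R * h = a + k.+1%:R * h - h by rewrite hS; ring.
  apply: (extremal_lintegral_left (i := k./2.+1)).
  - by rewrite (leq_trans _ kn)// kE' -addnn leq_addr.
  - by rewrite kE' h2.
  - by rewrite hS addrK.
  - exact: kb.
rewrite hS; apply: (extremal_lintegral_right (i := k./2)).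
- by rewrite (leq_trans _ (ltnW kn))// -{2}kE -addnn addnCA leq_addr.
- by rewrite -h2 -{1}kE.
- by rewrite -hS kb.
Qed.

Definition extremal_primitive t : X := theta +.: J a t.

Lemma extremal_primitive_W1Homega : W1Homega P omega a b extremal_primitive.
Proof.
exists theta, extremal; split => //; last exact: extremal_Homega.
by rewrite -isometric_line0; exact: L_convex.
Qed.

Lemma extremal_primitive_info :
  info (uniform_partition a b (n := n)) extremal_primitive = [ffun=> theta].
Proof.
apply/ffunP => k; rewrite !ffunE /extremal_primitive /uniform_partition.
have -> : k%:R * (b - a) / n%:R = k%:R * h.
  by rewrite -nhE mulrCA mulrC mulKf// pnatr_eq0 -lt0n.
by rewrite extremal_lintegral_node ?sadd0// -ltnS.
Qed.

(** The point [a] is an even node, where [omega] of the distance is [0] and only [- sg * e]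
    remains. *)
Lemma extremal_primitive_hderiv :
  hderiv a b extremal_primitive a = L (- sg * e).
Proof.
rewrite (hderiv_W1Homega isoX convP omegaP extremal_Homega (x0 := theta))//.
  rewrite (convexifying_fixed convP) /extremal; last exact: L_convex.
  rewrite subrr -[X in even_node_dist _ _ X]addr0 -{1}(mul0r (2 * h)).
  rewrite (@even_node_distE _ _ h_ge0 n 0)// ?normr0// (modulus0 omegaP).
  by congr L; ring.
by rewrite lexx ltW.
Qed.

End Extremal.

(** * The interpolating polygon and optimality *)

Section Polygon.
Context {R : realType} {X : lspaceType R}.
Variables (a b : R) (n : nat).
Hypotheses (ab : a < b) (n_gt0 : (0 < n)%N).
Local Notation t_ := (@uniform_partition R a b n).
Implicit Types (t : R) (k : 'I_n) (y : {ffun 'I_n.+1 -> X}).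

Let n0 : 0 < n%:R :> R. Proof. by rewrite ltr0n. Qed.

(** The test made by [hderiv_polygon]; closing the last cell makes the cells a partition of
    [[a, b]]. *)
Definition polygon_cell k t : bool :=
  (t_ (widen_ord (leqnSn n) k) <= t) &&
  ((t < t_ (lift ord0 k)) || (k.+1 == n) && (t == t_ (lift ord0 k))).

Definition polygon_slope y k : X :=
  (t_ (lift ord0 k) - t_ (widen_ord (leqnSn n) k))^-1 *.:
  hdiff (y (lift ord0 k)) (y (widen_ord (leqnSn n) k)).

Lemma uniform_partition_le (i j : 'I_n.+1) : (i <= j)%N -> t_ i <= t_ j.
Proof.
move=> ij; rewrite /uniform_partition lerD2l ler_pM2r ?invr_gt0//.
by rewrite ler_pM2r ?subr_gt0// ler_nat.
Qed.

Lemma uniform_partition_itv (i : 'I_n.+1) : a <= t_ i <= b.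
Proof.
apply/andP; split.
  by rewrite lerDl divr_ge0// mulr_ge0// subr_ge0 ltW.
rewrite /uniform_partition -lerBrDl ler_pdivrMr// mulrC ler_pM2l ?subr_gt0//.
by rewrite ler_nat -ltnS.
Qed.

Lemma uniform_partition_step k :
  t_ (lift ord0 k) - t_ (widen_ord (leqnSn n) k) = (b - a) / n%:R.
Proof.
rewrite /uniform_partition lift0/= opprD addrACA subrr add0r -mulrBl -mulrBl.
by rewrite -natrB// subSnn mul1r.
Qed.

(** As a right bound, [BSide true] excludes the endpoint and [BSide false] includes it. The interval
    form makes cells visibly measurable. *)
Lemma polygon_cellE k t : polygon_cell k t =
  (t \in Interval (BLeft (t_ (widen_ord (leqnSn n) k)))
     (BSide (k.+1 != n) (t_ (lift ord0 k)))).
Proof.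
rewrite /polygon_cell; case: eqP => _ /=; rewrite in_itv/=.
  by rewrite [t <= _]le_eqVlt orbC.
by rewrite orbF.
Qed.

Lemma polygon_cell_itv k t : polygon_cell k t ->
  t_ (widen_ord (leqnSn n) k) <= t <= t_ (lift ord0 k).
Proof. by case/andP => -> /orP[/ltW|/andP[_ /eqP ->]] /=. Qed.

Lemma polygon_cell_exists t : a <= t <= b -> exists k, polygon_cell k t.
Proof.
move=> /andP[at_ tb].
have h0 : 0 < (b - a) / n%:R by rewrite divr_gt0// subr_gt0.
have [tb'|bt] := ltP t b; last first.
  (* The right end [b] belongs to the last cell, of index [n.-1]. *)
  have pn : (n.-1 < n)%N by rewrite prednK.
  have -> : t = b by apply/eqP; rewrite eq_le tb bt.
  exists (Ordinal pn); apply/andP; split.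
    by have /andP[] :=
      uniform_partition_itv (widen_ord (leqnSn n) (Ordinal pn)).
  apply/orP; right; rewrite /uniform_partition lift0/= prednK// eqxx/=.
  by rewrite mulrAC (mulfV (lt0r_neq0 n0)) mul1r subrKC.
(* Otherwise the index is the integer part of [t - a] measured in cell lengths. *)
pose x := (t - a) / ((b - a) / n%:R).
have x0 : 0 <= x by rewrite divr_ge0 ?subr_ge0// ltW.
have /andP[ix xi] := truncn_itv x0.
have kn : (Num.truncn x < n)%N.
  rewrite truncn_lt_nat// ltr_pdivrMr// mulrC divfK ?gt_eqF//.
  by rewrite ltrD2r.
exists (Ordinal kn); rewrite /polygon_cell /uniform_partition lift0/=.
rewrite -lerBrDl -ltrBlDl -!mulrA -ler_pdivlMr// -ltr_pdivrMr//.
by rewrite ix xi.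
Qed.

(** Ensures that the [pick] in [hderiv_polygon] finds the intended cell. If [k < k'], then [t]
    reaches the right end of cell [k], which only the last cell allows. *)
Lemma polygon_cell_inj k k' t : polygon_cell k t -> polygon_cell k' t -> k = k'.
Proof.
wlog kk' : k k' / (k <= k')%N.
  move=> H; have [?|/ltnW ?] := leqP k k'; first exact: H.
  by move=> ? ?; apply/esym; exact: H.
move: kk'; rewrite leq_eqVlt => /predU1P[kk' _ _|kk']; first exact: val_inj.
move=> /andP[_ tk] /andP[k't _].
have tk' : t_ (lift ord0 k) <= t.
  by apply: le_trans k't; apply: uniform_partition_le; rewrite lift0.
have /eqP kn : k.+1 == n by move: tk; rewrite ltNge tk' => /andP[].
by have := leq_ltn_trans kk' (ltn_ord k'); rewrite kn ltnn.
Qed.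

Lemma hderiv_polygonE y k t : polygon_cell k t ->
  hderiv_polygon t_ y t = polygon_slope y k.
Proof.
move=> kt; rewrite /hderiv_polygon.
case: pickP => [k' k't|/(_ k)]; last by rewrite -/(polygon_cell k t) kt.
by rewrite /polygon_slope (polygon_cell_inj kt k't).
Qed.

(** On [[a, b]] this is a step function, so each preimage is a finite union of cells, and the sum of
    the norms of all slopes is a bound. *)
Lemma hderiv_polygon_bounded_measurable y :
  bounded_measurable a b (hderiv_polygon t_ y).
Proof.
split=> [x _ /= Y mY|].
  have -> : `[a, b] `&` (fun t => mdist (hderiv_polygon t_ y t) x) @^-1` Y =
      \bigcup_(k in [set k | Y (mdist (polygon_slope y k) x)])
        [set` Interval (BLeft (t_ (widen_ord (leqnSn n) k)))
           (BSide (k.+1 != n) (t_ (lift ord0 k)))].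
    apply/seteqP; split => t /=.
      rewrite in_itv/= => -[/polygon_cell_exists[k kt]].
      by rewrite (hderiv_polygonE y kt) => Yk; exists k; rewrite //= -polygon_cellE.
    case=> k /= Yk; rewrite -polygon_cellE => kt.
    rewrite (hderiv_polygonE y kt); split => //.
    have /andP[kt1 tk2] := polygon_cell_itv kt.
    have /andP[ak _] := uniform_partition_itv (widen_ord (leqnSn n) k).
    have /andP[_ kb] := uniform_partition_itv (lift ord0 k).
    by rewrite in_itv/= (le_trans ak kt1) (le_trans tk2 kb).
  apply: fin_bigcup_measurable; first exact: finite_finset.
  by move=> k _; exact: lebesgueTypeR_measurable_itv.
exists (\sum_k mdist (polygon_slope y k) theta) => t.
rewrite in_itv/= => /polygon_cell_exists[k kt].
rewrite (hderiv_polygonE y kt) (bigD1 k)//= lerDl.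
by apply: sumr_ge0 => *; exact: mdist_ge0.
Qed.

End Polygon.

(** * Upper and lower bounds for the error *)

Section Optimality.
Context {R : realType} {X : lspaceType R} (P : X -> X) (omega : R -> R).
Hypotheses (isoX : isotropic X) (convP : convexifying P).
Hypothesis omegaP : modulus_of_continuity omega.
Hypothesis inv_conv :
  invertible_elements X `&` convex_elements X <> [set theta].
Variables (a b : R) (n : nat).
Hypotheses (ab : a < b) (n_gt0 : (0 < n)%N).
Local Notation W := (W1Homega P omega a b).
Local Notation t_ := (@uniform_partition R a b n).
Local Notation h := ((b - a) / n%:R).
Local Notation e := (h^-1 * modulus_integral omega h).

(** This is [mean_dist] on the cell containing [t]. *)
Lemma polygon_error_le :
  (recovery_error (@sup_dist R X a b) (hderiv a b) W (info t_)
    (hderiv_polygon t_) <= e%:E)%E.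
Proof.
apply: ge_ereal_sup => _ [f [x [phi [cx phiH fE]]] <-].
apply: ge_ereal_sup => _ [t /= + <-]; rewrite in_itv/= => atb.
have [k kt] := polygon_cell_exists ab n_gt0 atb.
rewrite lee_fin (hderiv_W1Homega isoX convP omegaP phiH ab fE atb).
rewrite (hderiv_polygonE ab n_gt0 _ kt) /polygon_slope !ffunE.
have /andP[kt1 tk2] := polygon_cell_itv kt.
have /andP[ak _] := uniform_partition_itv ab n_gt0 (widen_ord (leqnSn n) k).
have /andP[_ kb] := uniform_partition_itv ab n_gt0 (lift ord0 k).
rewrite (W1Homega_hdiff isoX convP omegaP phiH fE)//; last exact: le_trans tk2.
rewrite -(uniform_partition_step a b k).
apply: (mean_dist convP omegaP phiH) => //.
by rewrite -subr_gt0 uniform_partition_step divr_gt0 ?subr_gt0// ltr0n.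
Qed.

(** Both extremal primitives carry the same information, so [Phi] returns one value at [a] for the
    two; it cannot be closer than [e] to both [L (- e)] and [L e]. *)
Lemma le_recovery_error (Phi : {ffun 'I_n.+1 -> X} -> R -> X) :
  (e%:E <= recovery_error (@sup_dist R X a b) (hderiv a b) W (info t_) Phi)%E.
Proof.
have [L [LD L_dist LM L_convex]] := isometric_line isoX inv_conv.
have n0 : 0 < n%:R :> R by rewrite ltr0n.
have h0 : 0 < h by rewrite divr_gt0// subr_gt0.
have nhE : n%:R * h = b - a by rewrite mulrC divfK// gt_eqF.
have ehE : e * h = modulus_integral omega h.
  by rewrite mulrAC mulVf ?mul1r// gt_eqF.
have e0 : 0 <= e.
  by rewrite mulr_ge0 ?invr_ge0 ?(ltW h0)// modulus_integral_ge0// ltW.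
have s1 : `|1 : R| = 1 by rewrite normr1.
have sN1 : `|- 1 : R| = 1 by rewrite normrN1.
pose f sg := extremal_primitive P omega L a n sg h e : R -> X.
have err (sg : R) : `|sg| = 1 ->
    ((mdist (L (- sg * e)) (Phi [ffun=> theta] a))%:E <=
    recovery_error (@sup_dist R X a b) (hderiv a b) W (info t_) Phi)%E.
  move=> sg1; apply: le_trans (ereal_sup_ubound _); last first.
    exists (f sg) => //.
    exact: extremal_primitive_W1Homega.
  rewrite (extremal_primitive_info convP omegaP LD L_dist LM L_convex)//.
  apply: ereal_sup_ubound; exists a; first by rewrite /= in_itv/= lexx ltW.
  by rewrite (extremal_primitive_hderiv isoX convP omegaP L_dist L_convex).
rewrite leNgt; apply/negP => lt_e.
have := le_lt_trans (err _ s1) lt_e; have := le_lt_trans (err _ sN1) lt_e.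
rewrite !lte_fin (_ : - -1 * e = e) 1?(_ : -1 * e = - e); try by ring.
move=> d1 d2.
(* [L e] and [L (- e)] are [2 * e] apart, whereas [d1] and [d2] would bring them closer. *)
have := metric_triangle (L e) (Phi [ffun=> theta] a) (L (- e)).
rewrite (metric_sym (Phi _ a)) L_dist opprK ger0_norm ?addr_ge0//; lra.
Qed.

End Optimality.

Theorem theorem6 (R : realType) (X : lspaceType R)
    (isoX : isotropic X)
    (inv_conv : invertible_elements X `&` convex_elements X <> [set theta])
    (P : X -> X) (convP : convexifying P)
    (omega : R -> R) (omegaP : modulus_of_continuity omega)
    (a b : R) (ab : a < b) (n : nat) (n_gt0 : (0 < n)%N) :
  let B := @bounded_measurable R X a b in
  let h := @sup_dist R X a b in
  let W := W1Homega P omega a b in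
  let D_H := @hderiv R X a b in
  let t_ := @uniform_partition R a b n in
  let I_t := @info R X n t_ in
  let Phi := @hderiv_polygon R X n t_ in
  let e := n%:R / (b - a) *
    \int[lebesgue_measure]_(u in `[0, (b - a) / n%:R]) omega u in
  optimal_recovery_error B h D_H W I_t = e%:E /\
  (recovery_methods B W I_t Phi /\ recovery_error h D_H W I_t Phi = e%:E).
Proof.
(* The factor [n%:R / (b - a)] becomes the inverse of the cell length, the form used in both
   bounds. *)
move=> B h W D_H t_ I_t Phi; rewrite -invf_div => e.
have le_e := le_recovery_error isoX convP omegaP inv_conv ab n_gt0.
have PhiB : recovery_methods B W I_t Phi.
  by move=> f _; exact: hderiv_polygon_bounded_measurable.
have PhiE : recovery_error h D_H W I_t Phi = e%:E.
  by apply/eqP; rewrite eq_le polygon_error_le// le_e.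
(* The polygon method is admissible and attains [e], which bounds the error of every method from
   below. *)
split=> //; apply/eqP; rewrite eq_le; apply/andP; split.
  by rewrite -PhiE; apply: ereal_inf_lbound; exists Phi.
by apply: le_ereal_inf_tmp => _ [Phi' _ <-]; exact: le_e.
Qed.
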